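(* Let $A$ be a category. There exist a 2-category $\hat{A}$ and a pseudo-functor $T:A\to\hat{A}$ such that for each 2-category $\mathcal{C}$, pre-composition with $T$ is an isomorphism of 2-categories $$\mathcal{H}om_p(\hat{A},\mathcal{C})\xrightarrow{\ T^*\ }p\mathcal{H}om_p(A,\mathcal{C}).$$ Furthermore, if $A$ is filtered, then $T$ is 2-cofinal.
   Context: A category is regarded as a 2-category with only identity 2-cells. $\mathcal{H}om_p(\mathcal{A},\mathcal{C})$ (respectively $p\mathcal{H}om_p(\mathcal{A},\mathcal{C})$) is the 2-category of 2-functors (respectively pseudo-functors) $\mathcal{A}\to\mathcal{C}$, pseudo-natural transformations and modifications. A non-empty 2-category $\mathcal{I}$ is 2-filtered if (F0) any two objects $i,j$ admit arrows $i\to k$, $j\to k$; (F1) for $f,g:i\to j$ there are $h:j\to k$ and an invertible 2-cell $hf\Rightarrow hg$; (F2) for 2-cells $\alpha,\beta:f\Rightarrow g:i\to j$ there is $h:j\to k$ with $h\alpha=h\beta$. A pseudo-functor $F:\mathcal{I}\to\mathcal{J}$ with $\mathcal{I}$ 2-filtered is 2-cofinal if (CF0) for each $j\in\mathcal{J}$ there are $i\in\mathcal{I}$ and an arrow $j\to Fi$; (CF1) for $a,b:j\to Fi$ there are $u:i\to i'$ in $\mathcal{I}$ and an invertible 2-cell $F(u)a\Rightarrow F(u)b$; (CF2) for 2-cells $\alpha,\beta:a\Rightarrow b:j\to Fi$ there is $u:i\to i'$ with $F(u)\alpha=F(u)\beta$. *)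

(* Defs.v *)
From Corelib Require Import ssreflect ssrbool.
From Stdlib Require Import FunctionalExtensionality ProofIrrelevance ClassicalEpsilon.

Set Implicit Arguments.
Unset Strict Implicit.
Unset Printing Implicit Defensive.

(** Two indexed elements, of possibly different indices, are equal when their
    indices are equal and they correspond along these equalities.  In a
    2-category this expresses that two 2-cells are the same although their
    sources and targets agree only up to a strict associativity or unit law. *)
Definition heq {H : Type} {C : H -> H -> Type} {f g f' g' : H}
    (a : C f g) (b : C f' g') : Prop :=
  existT (fun p => C (fst p) (snd p)) (f, g) a =
  existT (fun p => C (fst p) (snd p)) (f', g') b.
Notation "a ≅ b" := (heq a b) (at level 70).

(** 2-categories are strict.  Compositions are written in the usual right-to-left
    order, for 1-cells as well as for 2-cells, vertically and horizontally. *)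
Record twocat := TwoCat {
  ob :> Type;
  hom : ob -> ob -> Type;
  cell : forall x y, hom x y -> hom x y -> Type;
  id1 : forall x, hom x x;
  comp1 : forall x y z, hom y z -> hom x y -> hom x z;
  id2 : forall x y (f : hom x y), cell f f;
  vcomp : forall x y (f g h : hom x y), cell g h -> cell f g -> cell f h;
  hcomp : forall x y z (f f' : hom x y) (g g' : hom y z),
    cell g g' -> cell f f' -> cell (comp1 g f) (comp1 g' f');
  comp1A : forall x y z t (f : hom x y) (g : hom y z) (h : hom z t),
    comp1 h (comp1 g f) = comp1 (comp1 h g) f;
  comp1l : forall x y (f : hom x y), comp1 (id1 y) f = f;
  comp1r : forall x y (f : hom x y), comp1 f (id1 x) = f;
  vcompA : forall x y (f g h k : hom x y)
      (a : cell f g) (b : cell g h) (c : cell h k),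
    vcomp c (vcomp b a) = vcomp (vcomp c b) a;
  vcompl : forall x y (f g : hom x y) (a : cell f g), vcomp (id2 g) a = a;
  vcompr : forall x y (f g : hom x y) (a : cell f g), vcomp a (id2 f) = a;
  hcomp_id2 : forall x y z (f : hom x y) (g : hom y z),
    hcomp (id2 g) (id2 f) = id2 (comp1 g f);
  hcomp_vcomp : forall x y z (f f' f'' : hom x y) (g g' g'' : hom y z)
      (a : cell f f') (a' : cell f' f'') (b : cell g g') (b' : cell g' g''),
    hcomp (vcomp b' b) (vcomp a' a) = vcomp (hcomp b' a') (hcomp b a);
  hcompA : forall x y z t (f f' : hom x y) (g g' : hom y z) (h h' : hom z t)
      (a : cell f f') (b : cell g g') (c : cell h h'),
    hcomp c (hcomp b a) ≅ hcomp (hcomp c b) a;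
  hcompl : forall x y (f f' : hom x y) (a : cell f f'),
    hcomp (id2 (id1 y)) a ≅ a;
  hcompr : forall x y (f f' : hom x y) (a : cell f f'),
    hcomp a (id2 (id1 x)) ≅ a }.

Arguments hom {_} _ _.
Arguments cell {_ _ _} _ _.
Arguments id1 {_} _.
Arguments id2 {_ _ _} _.
Notation "g ∘ f" := (comp1 g f) (at level 40, left associativity).
Notation "b • a" := (vcomp b a) (at level 45, right associativity).
Notation "b ∗ a" := (hcomp b a) (at level 40, left associativity).

(** The identity 2-cell between two equal 1-cells. *)
Definition idcell (C : twocat) (x y : C) (f g : hom x y) (e : f = g) : cell f g :=
  match e in _ = g return cell f g with eq_refl => id2 f end.

Definition invertible (C : twocat) (x y : C) (f g : hom x y) (a : cell f g) : Prop :=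
  exists b : cell g f, b • a = id2 f /\ a • b = id2 g.

Record category := Category {
  cob :> Type;
  chom : cob -> cob -> Type;
  cid : forall x, chom x x;
  ccomp : forall x y z, chom y z -> chom x y -> chom x z;
  ccompA : forall x y z t (f : chom x y) (g : chom y z) (h : chom z t),
    ccomp h (ccomp g f) = ccomp (ccomp h g) f;
  ccompl : forall x y (f : chom x y), ccomp (cid y) f = f;
  ccompr : forall x y (f : chom x y), ccomp f (cid x) = f }.

Arguments chom {_} _ _.

Lemma heq_eq (H : Type) (C : H -> H -> Type) (f g : H) (a b : C f g) : a ≅ b -> a = b.
Proof. exact: inj_pair2. Qed.

Lemma heq_prop (H : Type) (C : H -> H -> Prop) (f g f' g' : H) (a : C f g) (b : C f' g') :
  f = f' -> g = g' -> heq (C := C) a b.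
Proof. by move=> e e'; subst; rewrite (proof_irrelevance _ a b). Qed.

(** A category as a 2-category with only identity 2-cells: a 2-cell from f to g
    is a proof of f = g. *)
Program Definition disc (A : category) : twocat := {|
  ob := A;
  hom := @chom A;
  cell := fun x y f g => f = g;
  id1 := @cid A;
  comp1 := @ccomp A;
  id2 := fun x y f => eq_refl;
  vcomp := fun x y f g h b a => eq_trans a b;
  hcomp := fun x y z f f' g g' b a => f_equal2 (@ccomp A x y z) b a;
  comp1A := @ccompA A;
  comp1l := @ccompl A;
  comp1r := @ccompr A |}.
Solve All Obligations with
  try (intros; apply: proof_irrelevance);
  intros; subst; apply: heq_prop; rewrite ?ccompA ?ccompl ?ccompr; reflexivity.

Record pseudofunctor (A B : twocat) := Pseudofunctor {
  pf_ob :> A -> B;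
  pf_hom : forall x y, hom x y -> hom (pf_ob x) (pf_ob y);
  pf_cell : forall x y (f g : hom x y), cell f g -> cell (pf_hom f) (pf_hom g);
  pf_unit : forall x, cell (id1 (pf_ob x)) (pf_hom (id1 x));
  pf_mult : forall x y z (f : hom x y) (g : hom y z),
    cell (pf_hom g ∘ pf_hom f) (pf_hom (g ∘ f));
  pf_id2 : forall x y (f : hom x y), pf_cell (id2 f) = id2 (pf_hom f);
  pf_vcomp : forall x y (f g h : hom x y) (a : cell f g) (b : cell g h),
    pf_cell (b • a) = pf_cell b • pf_cell a;
  pf_unit_inv : forall x, invertible (pf_unit x);
  pf_mult_inv : forall x y z (f : hom x y) (g : hom y z), invertible (pf_mult f g);
  pf_mult_nat : forall x y z (f f' : hom x y) (g g' : hom y z)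
      (a : cell f f') (b : cell g g'),
    pf_cell (b ∗ a) • pf_mult f g = pf_mult f' g' • (pf_cell b ∗ pf_cell a);
  pf_unitl : forall x y (f : hom x y),
    pf_mult f (id1 y) • (pf_unit y ∗ id2 (pf_hom f)) ≅ id2 (pf_hom f);
  pf_unitr : forall x y (f : hom x y),
    pf_mult (id1 x) f • (id2 (pf_hom f) ∗ pf_unit x) ≅ id2 (pf_hom f);
  pf_assoc : forall x y z t (f : hom x y) (g : hom y z) (h : hom z t),
    pf_mult (g ∘ f) h • (id2 (pf_hom h) ∗ pf_mult f g) ≅
    pf_mult f (h ∘ g) • (pf_mult g h ∗ id2 (pf_hom f)) }.

Arguments pf_hom {A B} _ {x y} _.
Arguments pf_cell {A B} _ {x y f g} _.
Arguments pf_unit {A B} _ _.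
Arguments pf_mult {A B} _ {x y z} _ _.

Record twofunctor (A B : twocat) := Twofunctor {
  tf_ob :> A -> B;
  tf_hom : forall x y, hom x y -> hom (tf_ob x) (tf_ob y);
  tf_cell : forall x y (f g : hom x y), cell f g -> cell (tf_hom f) (tf_hom g);
  tf_id1 : forall x, tf_hom (id1 x) = id1 (tf_ob x);
  tf_comp1 : forall x y z (f : hom x y) (g : hom y z),
    tf_hom (g ∘ f) = tf_hom g ∘ tf_hom f;
  tf_id2 : forall x y (f : hom x y), tf_cell (id2 f) = id2 (tf_hom f);
  tf_vcomp : forall x y (f g h : hom x y) (a : cell f g) (b : cell g h),
    tf_cell (b • a) = tf_cell b • tf_cell a;
  tf_hcomp : forall x y z (f f' : hom x y) (g g' : hom y z)
      (a : cell f f') (b : cell g g'),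
    tf_cell (b ∗ a) ≅ tf_cell b ∗ tf_cell a }.

Arguments tf_hom {A B} _ {x y} _.
Arguments tf_cell {A B} _ {x y f g} _.

(** In the last axiom the [idcell]s are the strict associativities needed to
    make the pasting composable. *)
Record pseudonat (A B : twocat) (F G : pseudofunctor A B) := Pseudonat {
  pn_ob :> forall x, hom (F x) (G x);
  pn_cell : forall x y (f : hom x y),
    cell (pf_hom G f ∘ pn_ob x) (pn_ob y ∘ pf_hom F f);
  pn_inv : forall x y (f : hom x y), invertible (pn_cell f);
  pn_nat : forall x y (f g : hom x y) (a : cell f g),
    pn_cell g • (pf_cell G a ∗ id2 (pn_ob x)) =
    (id2 (pn_ob y) ∗ pf_cell F a) • pn_cell f;
  pn_unit : forall x,
    pn_cell (id1 x) • (pf_unit G x ∗ id2 (pn_ob x)) ≅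
    id2 (pn_ob x) ∗ pf_unit F x;
  pn_mult : forall x y z (f : hom x y) (g : hom y z),
    pn_cell (g ∘ f) • (pf_mult G f g ∗ id2 (pn_ob x)) ≅
    (id2 (pn_ob z) ∗ pf_mult F f g) •
    idcell (eq_sym (comp1A (pf_hom F f) (pf_hom F g) (pn_ob z))) •
    (pn_cell g ∗ id2 (pf_hom F f)) •
    idcell (comp1A (pf_hom F f) (pn_ob y) (pf_hom G g)) •
    (id2 (pf_hom G g) ∗ pn_cell f) }.

Arguments pn_cell {A B F G} _ {x y} _.

Record modif (A B : twocat) (F G : pseudofunctor A B) (s t : pseudonat F G) := Modif {
  mo_cell :> forall x, cell (s x) (t x);
  mo_nat : forall x y (f : hom x y),
    pn_cell t f • (id2 (pf_hom G f) ∗ mo_cell x) =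
    (mo_cell y ∗ id2 (pf_hom F f)) • pn_cell s f }.

Lemma pseudonat_eq (A B : twocat) (F G : pseudofunctor A B) (s t : pseudonat F G) :
  (forall x, s x = t x) ->
  (forall x y (f : hom x y), pn_cell s f ≅ pn_cell t f) -> s = t.
Proof.
case: s t => [s sc p1 p2 p3 p4] [t tc q1 q2 q3 q4] /= e.
have {}e : s = t by apply: functional_extensionality_dep.
subst t => e.
have {}e : sc = tc.
  do 3![apply: functional_extensionality_dep => ?]; exact: heq_eq.
by subst tc; f_equal; apply: proof_irrelevance.
Qed.

Lemma modif_eq (A B : twocat) (F G : pseudofunctor A B) (s t : pseudonat F G)
  (m n : modif s t) : (forall x, m x = n x) -> m = n.
Proof.
case: m n => [m p] [n q] /= e.
have {}e : m = n by apply: functional_extensionality_dep.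
by subst n; f_equal; apply: proof_irrelevance.
Qed.

Lemma modif_heq (A B : twocat) (F G : pseudofunctor A B) (s t s' t' : pseudonat F G)
  (m : modif s t) (n : modif s' t') :
  s = s' -> t = t' -> (forall x, m x ≅ n x) -> m ≅ n.
Proof.
move=> e e' E; subst s' t'; have -> // : m = n.
by apply: modif_eq => x; apply: heq_eq.
Qed.

(** A calculus of 2-cells without typing constraints, used only in proofs:
    [pk a] forgets the source and target of [a], and [None] stands for an
    ill-formed pasting. *)
Definition pack (C : twocat) (x y : C) :=
  option {p : hom x y * hom x y & cell (fst p) (snd p)}.

Section Pack.
Variable C : twocat.
Implicit Types x y z t : C.

Definition pk x y (f g : hom x y) (a : cell f g) : pack x y :=
  Some (existT (fun p => cell (fst p) (snd p)) (f, g) a).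

Definition pid x y (f : hom x y) := pk (id2 f).

Definition pV x y (b a : pack x y) : pack x y :=
  match b, a with
  | Some (existT _ (g', h) b), Some (existT _ (f, g) a) =>
    match excluded_middle_informative (g = g') with
    | left e => pk ((b : cell g' h) • idcell e • (a : cell f g))
    | right _ => None
    end
  | _, _ => None
  end.

Definition pH x y z (b : pack y z) (a : pack x y) : pack x z :=
  match b, a with
  | Some (existT _ (g, g') b), Some (existT _ (f, f') a) =>
    pk ((b : cell g g') ∗ (a : cell f f'))
  | _, _ => None
  end.

Definition typed x y (a : pack x y) (f g : hom x y) : Prop :=
  exists c : cell f g, a = pk c.

Lemma pk_heq x y (f g f' g' : hom x y) (a : cell f g) (b : cell f' g') :
  a ≅ b <-> pk a = pk b.
Proof.
split=> [E|E]; first by rewrite /pk E.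
exact: (f_equal (fun o => if o is Some q then q else existT _ (f, g) a) E).
Qed.

Lemma pk_idcell x y (f g : hom x y) (e : f = g) : pk (idcell e) = pid f.
Proof. by subst g. Qed.

Lemma pk_vcomp x y (f g h : hom x y) (b : cell g h) (a : cell f g) :
  pk (b • a) = pV (pk b) (pk a).
Proof.
rewrite /pV /pk; case: excluded_middle_informative => [e|//].
by rewrite (proof_irrelevance _ e eq_refl) /= vcompl.
Qed.

Lemma pk_hcomp x y z (f f' : hom x y) (g g' : hom y z) (b : cell g g') (a : cell f f') :
  pk (b ∗ a) = pH (pk b) (pk a).
Proof. by []. Qed.

Lemma typed_pk x y (f g : hom x y) (a : cell f g) : typed (pk a) f g.
Proof. by exists a. Qed.

Lemma typed_pid x y (f : hom x y) : typed (pid f) f f.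
Proof. exact: typed_pk. Qed.

Lemma typed_pV x y (f g g' h : hom x y) (b a : pack x y) :
  typed b g' h -> typed a f g -> g = g' -> typed (pV b a) f h.
Proof. by move=> [b' ->] [a' ->] e; subst g'; rewrite -pk_vcomp; exists (b' • a'). Qed.

Lemma typed_pH x y z (f f' : hom x y) (g g' : hom y z) b a :
  typed b g g' -> typed a f f' -> typed (pH b a) (g ∘ f) (g' ∘ f').
Proof. by move=> [b' ->] [a' ->]; exists (b' ∗ a'). Qed.

Lemma typed_conv x y (a : pack x y) (f g f' g' : hom x y) :
  typed a f g -> f = f' -> g = g' -> typed a f' g'.
Proof. by move=> ta <- <-. Qed.

Lemma pVA x y (c b a : pack x y) : pV (pV c b) a = pV c (pV b a).
Proof.
case: c => [[[h' k] c]|//]; case: b => [[[g' h] b]|//].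
case: a => [[[f g] a]|]; rewrite /pV /=; last by case: excluded_middle_informative.
case: (excluded_middle_informative (h = h')) => [e|ne];
case: (excluded_middle_informative (g = g')) => [e'|ne'] //=.
- subst; case: excluded_middle_informative => // e; case: excluded_middle_informative => // e'.
  rewrite (proof_irrelevance _ e eq_refl) (proof_irrelevance _ e' eq_refl) /=.
  by rewrite !vcompl !vcompA.
- by case: excluded_middle_informative.
- by case: excluded_middle_informative.
Qed.

Lemma pV_idl x y (a : pack x y) (f g h : hom x y) : typed a f g -> g = h -> pV (pid h) a = a.
Proof. by move=> [c ->] <-; rewrite -pk_vcomp vcompl. Qed.

Lemma pV_idr x y (a : pack x y) (f g h : hom x y) : typed a f g -> f = h -> pV a (pid h) = a.
Proof. by move=> [c ->] <-; rewrite -pk_vcomp vcompr. Qed.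

Lemma pHA x y z t (a : pack x y) (b : pack y z) (c : pack z t) :
  pH (pH c b) a = pH c (pH b a).
Proof.
case: c => [[[h h'] c]|//]; case: b => [[[g g'] b]|//]; case: a => [[[f f'] a]|//].
by symmetry; apply/pk_heq/hcompA.
Qed.

Lemma pH_id x y z (f : hom x y) (g : hom y z) : pH (pid g) (pid f) = pid (g ∘ f).
Proof. by rewrite -pk_hcomp hcomp_id2. Qed.

Lemma pH_idl x y (a : pack x y) : pH (pid (id1 y)) a = a.
Proof. by case: a => [[[f f'] a]|//]; apply/pk_heq/hcompl. Qed.

Lemma pH_idr x y (a : pack x y) : pH a (pid (id1 x)) = a.
Proof. by case: a => [[[f f'] a]|//]; apply/pk_heq/hcompr. Qed.

Lemma pH_pV x y z (f f' g' f'' : hom x y) (h h' k' h'' : hom y z) b' b a' a :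
  typed b h h' -> typed b' k' h'' -> typed a f f' -> typed a' g' f'' ->
  h' = k' -> f' = g' ->
  pH (pV b' b) (pV a' a) = pV (pH b' a') (pH b a).
Proof.
move=> [? ->] [? ->] [? ->] [? ->] e e'; subst.
by rewrite -!pk_vcomp -pk_hcomp hcomp_vcomp.
Qed.

End Pack.

Lemma pk_id2 (C : twocat) (x y : C) (f : hom x y) : pk (id2 f) = pid f.
Proof. by []. Qed.

Opaque pk pid pV pH.

Lemma pH_pid2 (C : twocat) (x y z t : C) (f : hom y z) (g : hom z t) (a : pack x y) :
  pH (pid g) (pH (pid f) a) = pH (pid (g ∘ f)) a.
Proof. by rewrite -pHA pH_id. Qed.

Lemma pH_pVl (C : twocat) (x y z : C) (f : hom x y) (h h' k' h'' : hom y z) b' b :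
  typed b h h' -> typed b' k' h'' -> h' = k' ->
  pH (pV b' b) (pid f) = pV (pH b' (pid f)) (pH b (pid f)).
Proof.
move=> tb tb' e; rewrite -{1}(pV_idl (typed_pid f) (eq_refl f)).
by rewrite (pH_pV tb tb' (typed_pid f) (typed_pid f)).
Qed.

Lemma pH_pVr (C : twocat) (x y z : C) (g : hom y z) (h h' k' h'' : hom x y) b' b :
  typed b h h' -> typed b' k' h'' -> h' = k' ->
  pH (pid g) (pV b' b) = pV (pH (pid g) b') (pH (pid g) b).
Proof.
move=> tb tb' e; rewrite -{1}(pV_idl (typed_pid g) (eq_refl g)).
by rewrite (pH_pV (typed_pid g) (typed_pid g) tb tb').
Qed.

Lemma pH_xch (C : twocat) (x y z : C) (f f' : hom x y) (g g' : hom y z) b a :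
  typed b g g' -> typed a f f' ->
  pV (pH b (pid f')) (pH (pid g) a) = pV (pH (pid g') a) (pH b (pid f)).
Proof.
move=> tb ta.
rewrite -(pH_pV (typed_pid g) tb ta (typed_pid f')) //.
rewrite -(pH_pV tb (typed_pid g') (typed_pid f) ta) //.
by rewrite (pV_idr tb) // (pV_idl ta) // (pV_idl tb) // (pV_idr ta).
Qed.

Lemma invertible_vcomp (C : twocat) (x y : C) (f g h : hom x y) (b : cell g h) (a : cell f g) :
  invertible b -> invertible a -> invertible (b • a).
Proof.
move=> [b' [b1 b2]] [a' [a1 a2]]; exists (a' • b'); split.
  by rewrite -vcompA (vcompA a) b1 vcompl.
by rewrite -vcompA (vcompA b') a2 vcompl.
Qed.

Lemma invertible_hcomp (C : twocat) (x y z : C) (f f' : hom x y) (g g' : hom y z)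
  (b : cell g g') (a : cell f f') : invertible b -> invertible a -> invertible (b ∗ a).
Proof.
move=> [b' [b1 b2]] [a' [a1 a2]]; exists (b' ∗ a').
by rewrite -!hcomp_vcomp b1 b2 a1 a2 !hcomp_id2.
Qed.

Lemma invertible_id2 (C : twocat) (x y : C) (f : hom x y) : invertible (id2 f).
Proof. by exists (id2 f); rewrite vcompl. Qed.

Lemma invertible_idcell (C : twocat) (x y : C) (f g : hom x y) (e : f = g) :
  invertible (idcell e).
Proof. by subst g; apply: invertible_id2. Qed.

Lemma eq_pk (C : twocat) (x y : C) (f g : hom x y) (a b : cell f g) : pk a = pk b -> a = b.
Proof. by move=> /pk_heq E; exact: heq_eq E. Qed.

Ltac eq1 := by rewrite ?(tf_comp1, tf_id1, comp1A, comp1l, comp1r).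
Ltac typ := by repeat first
  [ exact: typed_pk | exact: typed_pid
  | eapply typed_pV; [typ | typ | eq1] | eapply typed_pH; [typ | typ] ].
(** Normalization to vertical composites of whiskered cells, all composites
    being associated to the right. *)
Ltac pnorm := rewrite ?(pk_vcomp, pk_hcomp, pk_idcell, pk_id2);
  repeat first [ progress rewrite ?(pVA, pHA, pH_id, pH_pid2, pH_idl, pH_idr, comp1A, comp1l, comp1r)
               | erewrite pV_idl by first [typ | eq1]
               | erewrite pV_idr by first [typ | eq1]
               | erewrite pH_pVl by first [typ | eq1]
               | erewrite pH_pVr by first [typ | eq1] ].

Section PHom.
Variables A B : twocat.
Implicit Types F G H : pseudofunctor A B.

Program Definition pn_id F : pseudonat F F := {|
  pn_ob := fun x => id1 (F x);
  pn_cell := fun x y f => idcell (eq_trans (comp1r (pf_hom F f)) (eq_sym (comp1l _))) |}.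
Next Obligation. exact: invertible_idcell. Qed.
Next Obligation. by apply: eq_pk; pnorm. Qed.
Next Obligation. by apply/pk_heq; pnorm. Qed.
Next Obligation. by apply/pk_heq; pnorm. Qed.

Lemma pn_natP F G (s : pseudonat F G) x y (f g : hom x y) (a : cell f g) :
  pV (pk (pn_cell s g)) (pH (pk (pf_cell G a)) (pid (s x))) =
  pV (pH (pid (s y)) (pk (pf_cell F a))) (pk (pn_cell s f)).
Proof. by have := f_equal (@pk _ _ _ _ _) (pn_nat s a); rewrite !pk_vcomp. Qed.

Lemma pn_unitP F G (s : pseudonat F G) x :
  pV (pk (pn_cell s (id1 x))) (pH (pk (pf_unit G x)) (pid (s x))) =
  pH (pid (s x)) (pk (pf_unit F x)).
Proof. by have /pk_heq := pn_unit s x; rewrite pk_vcomp. Qed.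

Lemma pn_multP F G (s : pseudonat F G) x y z (f : hom x y) (g : hom y z) :
  pV (pk (pn_cell s (g ∘ f))) (pH (pk (pf_mult G f g)) (pid (s x))) =
  pV (pH (pid (s z)) (pk (pf_mult F f g)))
    (pV (pH (pk (pn_cell s g)) (pid (pf_hom F f)))
       (pH (pid (pf_hom G g)) (pk (pn_cell s f)))).
Proof. by have /pk_heq := pn_mult s f g; pnorm. Qed.

Program Definition pn_comp F G H (t : pseudonat G H) (s : pseudonat F G) : pseudonat F H := {|
  pn_ob := fun x => t x ∘ s x;
  pn_cell := fun x y f =>
    idcell (comp1A (pf_hom F f) (s y) (t y)) •
    (id2 (t y) ∗ pn_cell s f) •
    idcell (eq_sym (comp1A (s x) (pf_hom G f) (t y))) •
    (pn_cell t f ∗ id2 (s x)) •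
    idcell (comp1A (s x) (t x) (pf_hom H f)) |}.
Next Obligation.
have := @pn_inv _ _ _ _ s _ _ f; have := @pn_inv _ _ _ _ t _ _ f => ? ?.
by do ![apply: invertible_vcomp | apply: invertible_hcomp | apply: invertible_idcell
   | apply: invertible_id2].
Qed.
Next Obligation.
apply: eq_pk; pnorm.
rewrite -(pH_id (s x)) -(pHA _ _ (pk (pf_cell H a))).
erewrite <- (pH_pVl (s x)) by first [typ | eq1].
rewrite pn_natP. pnorm.
rewrite -pVA; erewrite <- (pH_pVr (t y)) by first [typ | eq1].
by rewrite pn_natP; pnorm.
Qed.
Next Obligation.
apply/pk_heq; pnorm.
rewrite -(pH_id (s x)) -(pHA _ _ (pk (pf_unit H x))).
erewrite <- (pH_pVl (s x)) by first [typ | eq1].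
rewrite pn_unitP pHA.
erewrite <- (pH_pVr (t x)) by first [typ | eq1].
by rewrite pn_unitP; pnorm.
Qed.
Next Obligation.
apply/pk_heq; pnorm.
rewrite -(pH_id (s x)) -(pHA _ _ (pk (pf_mult H f g))).
erewrite <- (pH_pVl (s x)) by first [typ | eq1].
rewrite pn_multP. pnorm.
rewrite -pVA; erewrite <- (pH_pVr (t z)) by first [typ | eq1].
rewrite pn_multP. pnorm.
do 2 f_equal; rewrite -2!pVA; f_equal.
by symmetry; apply: pH_xch; typ.
Qed.

Lemma pn_compA F G H K (s : pseudonat F G) (t : pseudonat G H) (u : pseudonat H K) :
  pn_comp u (pn_comp t s) = pn_comp (pn_comp u t) s.
Proof.
apply: pseudonat_eq => [x|x y f] /=; first exact: comp1A.
by apply/pk_heq; pnorm.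
Qed.

Lemma pn_compl F G (s : pseudonat F G) : pn_comp (pn_id G) s = s.
Proof.
apply: pseudonat_eq => [x|x y f] /=; first exact: comp1l.
by apply/pk_heq; pnorm.
Qed.

Lemma pn_compr F G (s : pseudonat F G) : pn_comp s (pn_id F) = s.
Proof.
apply: pseudonat_eq => [x|x y f] /=; first exact: comp1r.
by apply/pk_heq; pnorm.
Qed.

Lemma mo_natP F G (s t : pseudonat F G) (m : modif s t) x y (f : hom x y) :
  pV (pk (pn_cell t f)) (pH (pid (pf_hom G f)) (pk (m x))) =
  pV (pH (pk (m y)) (pid (pf_hom F f))) (pk (pn_cell s f)).
Proof. by have := f_equal (@pk _ _ _ _ _) (mo_nat m f); rewrite !pk_vcomp. Qed.

Program Definition mo_id F G (s : pseudonat F G) : modif s s := {|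
  mo_cell := fun x => id2 (s x) |}.
Next Obligation. by rewrite !hcomp_id2 vcompl vcompr. Qed.

Program Definition mo_vcomp F G (s t u : pseudonat F G) (n : modif t u) (m : modif s t) :
  modif s u := {| mo_cell := fun x => n x • m x |}.
Next Obligation.
apply: eq_pk; pnorm.
by rewrite -pVA mo_natP pVA mo_natP.
Qed.

Lemma hcomp_split (C : twocat) (x y z : C) (f f' : hom x y) (g g' : hom y z)
  (b : cell g g') (a : cell f f') : b ∗ a = (b ∗ id2 f') • (id2 g ∗ a).
Proof. by rewrite -hcomp_vcomp vcompl vcompr. Qed.

Program Definition mo_hcomp F G H (s s' : pseudonat F G) (t t' : pseudonat G H)
    (n : modif t t') (m : modif s s') : modif (pn_comp t s) (pn_comp t' s') := {|
  mo_cell := fun x => n x ∗ m x |}.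
Next Obligation.
rewrite /= (hcomp_split _ (m x)) (hcomp_split _ (m y)); apply: eq_pk; pnorm.
rewrite -(pVA (pH (pk (pn_cell t' f)) _)) -(pHA _ (pk (n x))).
erewrite <- (pH_pVl (s' x)) by first [typ | eq1].
rewrite mo_natP; pnorm.
erewrite (pH_xch (b := pk (pn_cell t f)) (a := pk (m x))) by typ.
rewrite -pVA; erewrite <- (pH_xch (b := pk (n y)) (a := pk (pn_cell s' f))) by typ.
rewrite pVA; f_equal.
rewrite -(pH_pid2 _ (t y)) -!pVA; f_equal.
erewrite <- (pH_pVr (t y)) by first [typ | eq1].
by rewrite mo_natP; pnorm.
Qed.

End PHom.

Program Definition pHom_p (A C : twocat) : twocat := {|
  ob := pseudofunctor A C;
  hom := @pseudonat A C;
  cell := @modif A C;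
  id1 := @pn_id A C;
  comp1 := @pn_comp A C;
  id2 := @mo_id A C;
  vcomp := @mo_vcomp A C;
  hcomp := fun F G H s s' t t' n m => mo_hcomp n m;
  comp1A := @pn_compA A C;
  comp1l := @pn_compl A C;
  comp1r := @pn_compr A C |}.
Next Obligation. by apply: modif_eq => i /=; rewrite vcompA. Qed.
Next Obligation. by apply: modif_eq => i /=; rewrite vcompl. Qed.
Next Obligation. by apply: modif_eq => i /=; rewrite vcompr. Qed.
Next Obligation. by apply: modif_eq => i /=; rewrite hcomp_id2. Qed.
Next Obligation. by apply: modif_eq => i /=; rewrite hcomp_vcomp. Qed.
Next Obligation. by apply: modif_heq => [||i]; rewrite ?pn_compA //; apply: hcompA. Qed.
Next Obligation. by apply: modif_heq => [||i]; rewrite ?pn_compl //; apply: hcompl. Qed.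
Next Obligation. by apply: modif_heq => [||i]; rewrite ?pn_compr //; apply: hcompr. Qed.

(** The 2-category with objects S and the 1-cells and 2-cells of C between
    their images under J. *)
Program Definition fullsub (C : twocat) (S : Type) (J : S -> C) : twocat := {|
  ob := S;
  hom := fun x y => @hom C (J x) (J y);
  cell := fun x y => @cell C (J x) (J y);
  id1 := fun x => id1 (J x);
  comp1 := fun x y z g f => g ∘ f;
  id2 := fun x y f => id2 f;
  vcomp := fun x y f g h b a => b • a;
  hcomp := fun x y z f f' g g' b a => b ∗ a;
  comp1A := fun x y z t => @comp1A C (J x) (J y) (J z) (J t);
  comp1l := fun x y => @comp1l C (J x) (J y);
  comp1r := fun x y => @comp1r C (J x) (J y);
  vcompA := fun x y => @vcompA C (J x) (J y);
  vcompl := fun x y => @vcompl C (J x) (J y);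
  vcompr := fun x y => @vcompr C (J x) (J y);
  hcomp_id2 := fun x y z => @hcomp_id2 C (J x) (J y) (J z);
  hcomp_vcomp := fun x y z => @hcomp_vcomp C (J x) (J y) (J z);
  hcompA := fun x y z t => @hcompA C (J x) (J y) (J z) (J t);
  hcompl := fun x y => @hcompl C (J x) (J y);
  hcompr := fun x y => @hcompr C (J x) (J y) |}.

Definition fullsub_incl (C : twocat) (S : Type) (J : S -> C) : twofunctor (fullsub J) C.
Proof.
refine (@Twofunctor (fullsub J) C J (fun x y f => f) (fun x y f g a => a) _ _ _ _ _) => //.
Defined.

Definition tf_id (A : twocat) : twofunctor A A.
Proof.
refine (@Twofunctor A A (fun x => x) (fun x y f => f) (fun x y f g a => a) _ _ _ _ _) => //.
Defined.

Lemma tf_heq (A B : twocat) (F : twofunctor A B) (x y : A) (f g f' g' : hom x y)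
  (a : cell f g) (b : cell f' g') : a ≅ b -> tf_cell F a ≅ tf_cell F b.
Proof.
move=> /pk_heq E; apply/pk_heq.
exact: (f_equal (fun o : pack x y =>
  if o is Some (existT _ _ c) then pk (tf_cell F c) else None) E).
Qed.

Lemma pf_heq (A B : twocat) (F : pseudofunctor A B) (x y : A) (f g f' g' : hom x y)
  (a : cell f g) (b : cell f' g') : a ≅ b -> pf_cell F a ≅ pf_cell F b.
Proof.
move=> /pk_heq E; apply/pk_heq.
exact: (f_equal (fun o : pack x y =>
  if o is Some (existT _ _ c) then pk (pf_cell F c) else None) E).
Qed.

Program Definition tf_comp (A B C : twocat) (G : twofunctor B C) (F : twofunctor A B) :
    twofunctor A C := {|
  tf_ob := fun x => G (F x);
  tf_hom := fun x y f => tf_hom G (tf_hom F f);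
  tf_cell := fun x y f g a => tf_cell G (tf_cell F a) |}.
Next Obligation. by rewrite !tf_id1. Qed.
Next Obligation. by rewrite !tf_comp1. Qed.
Next Obligation. by rewrite !tf_id2. Qed.
Next Obligation. by rewrite !tf_vcomp. Qed.
Next Obligation.
exact: eq_trans (tf_heq G (tf_hcomp F a b)) (tf_hcomp G _ _).
Qed.

(** Invertibility in the strict sense: F has an inverse 2-functor. *)
Definition isomorphism (A B : twocat) (F : twofunctor A B) : Prop :=
  exists G : twofunctor B A, tf_comp G F = tf_id A /\ tf_comp F G = tf_id B.

(** A 2-functor as a pseudo-functor with identity structural 2-cells. *)
Program Definition pseudo (A B : twocat) (F : twofunctor A B) : pseudofunctor A B := {|
  pf_ob := F;
  pf_hom := fun x y f => tf_hom F f;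
  pf_cell := fun x y f g a => tf_cell F a;
  pf_unit := fun x => idcell (eq_sym (tf_id1 F x));
  pf_mult := fun x y z f g => idcell (eq_sym (tf_comp1 F f g)) |}.
Next Obligation. exact: tf_id2. Qed.
Next Obligation. exact: tf_vcomp. Qed.
Next Obligation. exact: invertible_idcell. Qed.
Next Obligation. exact: invertible_idcell. Qed.
Next Obligation.
apply: eq_pk; have /pk_heq := tf_hcomp F a b; by pnorm.
Qed.
Next Obligation. by apply/pk_heq; pnorm; rewrite ?(tf_comp1, tf_id1); pnorm. Qed.
Next Obligation. by apply/pk_heq; pnorm; rewrite ?(tf_comp1, tf_id1); pnorm. Qed.
Next Obligation. by apply/pk_heq; pnorm; rewrite ?(tf_comp1, tf_id1); pnorm. Qed.

(** The full sub-2-category of [pHom_p A C] on the 2-functors. *)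
Definition Hom_p (A C : twocat) : twocat := @fullsub (pHom_p A C) (twofunctor A C) (@pseudo A C).

Definition Hom_p_incl (A C : twocat) : twofunctor (Hom_p A C) (pHom_p A C) :=
  @fullsub_incl (pHom_p A C) (twofunctor A C) (@pseudo A C).

Lemma pf_cell_inv (A B : twocat) (F : pseudofunctor A B) (x y : A) (f g : hom x y)
  (a : cell f g) : invertible a -> invertible (pf_cell F a).
Proof.
by move=> [b [e e']]; exists (pf_cell F b); rewrite -!pf_vcomp e e' !pf_id2.
Qed.

Program Definition pf_comp (A B C : twocat) (G : pseudofunctor B C) (F : pseudofunctor A B) :
    pseudofunctor A C := {|
  pf_ob := fun x => G (F x);
  pf_hom := fun x y f => pf_hom G (pf_hom F f);
  pf_cell := fun x y f g a => pf_cell G (pf_cell F a);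
  pf_unit := fun x => pf_cell G (pf_unit F x) • pf_unit G (F x);
  pf_mult := fun x y z f g =>
    pf_cell G (pf_mult F f g) • pf_mult G (pf_hom F f) (pf_hom F g) |}.
Next Obligation. by rewrite !pf_id2. Qed.
Next Obligation. by rewrite !pf_vcomp. Qed.
Next Obligation.
by apply: invertible_vcomp; [apply/pf_cell_inv/pf_unit_inv | apply: pf_unit_inv].
Qed.
Next Obligation.
by apply: invertible_vcomp; [apply/pf_cell_inv/pf_mult_inv | apply: pf_mult_inv].
Qed.
Next Obligation.
by rewrite -vcompA -pf_mult_nat !vcompA -!pf_vcomp pf_mult_nat.
Qed.
Next Obligation.
rewrite -(vcompl (id2 (pf_hom G _))) hcomp_vcomp -(pf_id2 G).
rewrite -vcompA (vcompA (_ ∗ pf_cell G _)) -pf_mult_nat -vcompA vcompA -pf_vcomp !pf_id2.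
apply/pk_heq; rewrite pk_vcomp.
rewrite (proj1 (pk_heq _ _) (pf_heq G (pf_unitl F f))).
rewrite (proj1 (pk_heq _ _) (pf_unitl G (pf_hom F f))).
by rewrite -pk_vcomp pf_id2 !vcompl.
Qed.
Next Obligation.
rewrite -(vcompl (id2 (pf_hom G _))) hcomp_vcomp -(pf_id2 G).
rewrite -vcompA (vcompA (_ ∗ pf_unit G _)) -pf_mult_nat -vcompA vcompA -pf_vcomp !pf_id2.
apply/pk_heq; rewrite pk_vcomp.
rewrite (proj1 (pk_heq _ _) (pf_heq G (pf_unitr F f))).
rewrite (proj1 (pk_heq _ _) (pf_unitr G (pf_hom F f))).
by rewrite -pk_vcomp pf_id2 !vcompl.
Qed.
Next Obligation.
rewrite -(vcompl (id2 (pf_hom G (pf_hom F h)))) -(vcompl (id2 (pf_hom G (pf_hom F f)))).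
rewrite !hcomp_vcomp -!(pf_id2 G).
rewrite -!vcompA (vcompA (_ ∗ pf_mult G _ _)) (vcompA (pf_mult G _ _ ∗ _)) -!pf_mult_nat -!vcompA !(vcompA _ (pf_cell G _) (pf_cell G _)) -!pf_vcomp !pf_id2.
apply/pk_heq; rewrite !(pk_vcomp (pf_cell G _)).
rewrite (proj1 (pk_heq _ _) (pf_heq G (pf_assoc F f g h))).
by rewrite (proj1 (pk_heq _ _) (pf_assoc G (pf_hom F f) (pf_hom F g) (pf_hom F h))).
Qed.

Section Precomp.
Variables (A B C : twocat) (T : pseudofunctor A B).
Implicit Types F G : pseudofunctor B C.

Program Definition pn_precomp F G (s : pseudonat F G) :
    pseudonat (pf_comp F T) (pf_comp G T) := {|
  pn_ob := fun x => s (T x);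
  pn_cell := fun x y f => pn_cell s (pf_hom T f) |}.
Next Obligation. exact: pn_inv. Qed.
Next Obligation. exact: pn_nat. Qed.
Next Obligation.
apply/pk_heq; pnorm.
by rewrite -pVA pn_natP pVA pn_unitP; pnorm.
Qed.
Next Obligation.
apply/pk_heq; pnorm.
by rewrite -pVA pn_natP pVA pn_multP; pnorm.
Qed.

Program Definition mo_precomp F G (s t : pseudonat F G) (m : modif s t) :
    modif (pn_precomp s) (pn_precomp t) := {| mo_cell := fun x => m (T x) |}.
Next Obligation. exact: mo_nat. Qed.

Program Definition precomp_p : twofunctor (pHom_p B C) (pHom_p A C) := {|
  tf_ob := fun F => pf_comp F T : pHom_p A C;
  tf_hom := fun F G s => pn_precomp s;
  tf_cell := fun F G s t m => mo_precomp m |}.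
Next Obligation. by apply: pseudonat_eq => [y|y z f]; last by apply/pk_heq; pnorm. Qed.
Next Obligation. by apply: pseudonat_eq. Qed.
Next Obligation. by apply: modif_eq. Qed.
Next Obligation. by apply: modif_eq. Qed.
Next Obligation. by apply: modif_heq => //; apply: pseudonat_eq. Qed.

(** Pre-composition with T, on 2-functors B -> C. *)
Definition precomp : twofunctor (Hom_p B C) (pHom_p A C) :=
  tf_comp precomp_p (Hom_p_incl B C).

End Precomp.

Definition filtered (A : category) : Prop :=
  [/\ inhabited A,
      forall i j : A, exists k, inhabited (chom i k) /\ inhabited (chom j k)
    & forall (i j : A) (f g : chom i j),
        exists (k : A) (h : chom j k), ccomp h f = ccomp h g].

Definition two_filtered (I : twocat) : Prop :=
  [/\ inhabited I,
      forall i j : I, exists k, inhabited (hom i k) /\ inhabited (hom j k),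
      forall (i j : I) (f g : hom i j), exists (k : I) (h : hom j k)
        (a : cell (h ∘ f) (h ∘ g)), invertible a
    & forall (i j : I) (f g : hom i j) (a b : cell f g), exists (k : I) (h : hom j k),
        id2 h ∗ a = id2 h ∗ b].

(** 2-cofinality is a notion about pseudo-functors with 2-filtered domain, which
    is included here as the first condition. *)
Definition two_cofinal (I J : twocat) (F : pseudofunctor I J) : Prop :=
  [/\ two_filtered I,
      forall j : J, exists i : I, inhabited (hom j (F i)),
      forall (j : J) (i : I) (a b : hom j (F i)), exists (i' : I) (u : hom i i')
        (c : cell (pf_hom F u ∘ a) (pf_hom F u ∘ b)), invertible c
    & forall (j : J) (i : I) (a b : hom j (F i)) (c d : cell a b),
        exists (i' : I) (u : hom i i'), id2 (pf_hom F u) ∗ c = id2 (pf_hom F u) ∗ d].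

(* Main.v *)
(** The 2-category on A has the paths of A as 1-cells, and exactly one 2-cell,
    invertible, between two paths with the same composite.  A pseudo-functor F
    on A sends a path to the composite of the images of its arrows; its
    structural 2-cells provide a canonical comparison to the image of the
    composite, and coherence makes these comparisons compatible with
    concatenation, so that F extends to a 2-functor.  Conversely, in this
    2-category each path p is isomorphic to the one-arrow path on its composite;
    naturality with respect to this isomorphism forces the value at p of any
    2-functor on 2-cells, of any transformation and of any modification. *)

From Corelib Require Import ssreflect ssrbool.
From Stdlib Require Import FunctionalExtensionality ProofIrrelevance ClassicalEpsilon.
Require Import Defs.

Set Implicit Arguments.
Unset Strict Implicit.
Unset Printing Implicit Defensive.

Arguments pk : simpl never.
Arguments pid : simpl never.
Arguments pV : simpl never.
Arguments pH : simpl never.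

(** * Transport of cells along equalities of objects *)

Section Cast.
Variable C : twocat.

Definition cast1 (x x' y y' : C) (e : x = x') (e' : y = y') : hom x y -> hom x' y' :=
  match e, e' with eq_refl, eq_refl => fun f => f end.

Definition cast2 (x x' y y' : C) (e : x = x') (e' : y = y') :
    forall f g : hom x y, cell f g -> cell (cast1 e e' f) (cast1 e e' g) :=
  match e, e' with eq_refl, eq_refl => fun f g a => a end.

Lemma cast1_id x x' (e : x = x') : cast1 e e (id1 x) = id1 x'.
Proof. by subst. Qed.

Lemma cast1_comp x x' y y' z z' (e : x = x') (e' : y = y') (e'' : z = z')
  (f : hom x y) (g : hom y z) : cast1 e e'' (g ∘ f) = cast1 e' e'' g ∘ cast1 e e' f.
Proof. by subst. Qed.

Lemma cast2_id x x' y y' (e : x = x') (e' : y = y') (f : hom x y) :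
  cast2 e e' (id2 f) = id2 (cast1 e e' f).
Proof. by subst. Qed.

Lemma cast2_vcomp x x' y y' (e : x = x') (e' : y = y') (f g h : hom x y)
  (a : cell f g) (b : cell g h) : cast2 e e' (b • a) = cast2 e e' b • cast2 e e' a.
Proof. by subst. Qed.

Lemma cast2_hcomp x x' y y' z z' (e : x = x') (e' : y = y') (e'' : z = z')
  (f f' : hom x y) (g g' : hom y z) (a : cell f f') (b : cell g g') :
  cast2 e e'' (b ∗ a) ≅ cast2 e' e'' b ∗ cast2 e e' a.
Proof. by subst. Qed.

End Cast.

(** * Heterogeneous equality of 2-cells *)

Lemma heq_sym (H : Type) (C : H -> H -> Type) (f g f' g' : H) (a : C f g) (b : C f' g') :
  a ≅ b -> b ≅ a.
Proof. by rewrite /heq => ->. Qed.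

Lemma heq_trans (H : Type) (C : H -> H -> Type) (f g f' g' f'' g'' : H)
  (a : C f g) (b : C f' g') (c : C f'' g'') : a ≅ b -> b ≅ c -> a ≅ c.
Proof. by rewrite /heq => ->. Qed.

Lemma heq_vcomp (C : twocat) (x y : C) (f g h f' g' h' : hom x y) (a : cell f g)
  (b : cell g h) (a' : cell f' g') (b' : cell g' h') :
  a ≅ a' -> b ≅ b' -> b • a ≅ b' • a'.
Proof. by move=> /pk_heq E /pk_heq E'; apply/pk_heq; rewrite !pk_vcomp E E'. Qed.

Lemma heq_hcomp (C : twocat) (x y z : C) (f g f' g' : hom x y) (h k h' k' : hom y z)
  (a : cell f g) (b : cell h k) (a' : cell f' g') (b' : cell h' k') :
  a ≅ a' -> b ≅ b' -> b ∗ a ≅ b' ∗ a'.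
Proof. by move=> /pk_heq E /pk_heq E'; apply/pk_heq; rewrite !pk_hcomp E E'. Qed.

Lemma heq_id2 (C : twocat) (x y : C) (f g : hom x y) : f = g -> id2 f ≅ id2 g.
Proof. by move=> ->. Qed.

Lemma heq_ends (C : twocat) (x y : C) (f g f' g' : hom x y) (a : cell f g)
  (b : cell f' g') : a ≅ b -> f = f' /\ g = g'.
Proof. by move=> E; have /= [] := f_equal (@projT1 _ _) E. Qed.

(** Once the object map of [P] is replaced by the identity, proof irrelevance turns every [e x] into
    reflexivity and the casts disappear. *)
Lemma tf_eq_id (A : twocat) (P : twofunctor A A) (e : forall x, x = P x) :
  (forall x y (f : hom x y), tf_hom P f = cast1 (e x) (e y) f) ->
  (forall x y (f g : hom x y) (a : cell f g), tf_cell P a ≅ cast2 (e x) (e y) a) ->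
  P = tf_id A.
Proof.
case: P e => o h c p1 p2 p3 p4 p5 /= e.
have E : o = fun x => x by apply: functional_extensionality => x; rewrite -e.
subst o; have {e}-> : e = fun x => eq_refl.
  by apply: functional_extensionality_dep => x; apply: proof_irrelevance.
move=> /= Eh.
have {}Eh : h = fun x y f => f by do 3![apply: functional_extensionality_dep => ?].
subst h => Ec.
have {}Ec : c = fun x y f g a => a.
  by do 5![apply: functional_extensionality_dep => ?]; apply: heq_eq.
by subst c; rewrite /tf_id; f_equal; apply: proof_irrelevance.
Qed.

(** * A criterion for strict isomorphism of 2-categories *)

Section Bijective.
Variables (A B : twocat) (F : twofunctor A B).

(** The proofs [e1] and [e1'] are arbitrary rather than induced by [e] and [e'], so that a given
    section identity at [F x] can be used; proof irrelevance makes the choice immaterial. *)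
Lemma tf_cast1 x x' y y' (e : x = x') (e' : y = y') (e1 : F x = F x') (e1' : F y = F y')
  (f : hom x y) : tf_hom F (cast1 e e' f) = cast1 e1 e1' (tf_hom F f).
Proof. by subst; rewrite (proof_irrelevance _ e1 eq_refl) (proof_irrelevance _ e1' eq_refl). Qed.

Lemma tf_cast2 x x' y y' (e : x = x') (e' : y = y') (e1 : F x = F x') (e1' : F y = F y')
  (f g : hom x y) (a : cell f g) : tf_cell F (cast2 e e' a) ≅ cast2 e1 e1' (tf_cell F a).
Proof. by subst; rewrite (proof_irrelevance _ e1 eq_refl) (proof_irrelevance _ e1' eq_refl). Qed.

Hypothesis inj1 : forall x y (f g : hom x y), tf_hom F f = tf_hom F g -> f = g.
Hypothesis inj2 : forall x y (f g : hom x y) (a b : cell f g),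
  tf_cell F a = tf_cell F b -> a = b.

Lemma tf_heq_inj x y (f g f' g' : hom x y) (a : cell f g) (b : cell f' g') :
  tf_cell F a ≅ tf_cell F b -> a ≅ b.
Proof.
move=> E; have [/inj1 e /inj1 e'] := heq_ends E; subst f' g'.
by rewrite (inj2 (heq_eq E)).
Qed.

(** The laws of the inverse need no separate argument: [F] preserves them, the casts preserve them,
    and [F] is injective on 1-cells and 2-cells. *)
Lemma bijective_isomorphism (r : B -> A) :
  (forall x, x = r (F x)) -> (forall y, y = F (r y)) ->
  (forall x y (h : hom (F x) (F y)), exists f, tf_hom F f = h) ->
  (forall x y (f g : hom x y) (c : cell (tf_hom F f) (tf_hom F g)),
     exists a, tf_cell F a = c) ->
  isomorphism F.
Proof.
move=> rF Fr surj1 surj2.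
(* Surjectivity is a mere existence, so a preimage of the transported 1-cell is picked by
   description. *)
have l1 y y' (h : hom y y') : {f : hom (r y) (r y') | tf_hom F f = cast1 (Fr y) (Fr y') h}.
  exact/constructive_indefinite_description/surj1.
pose k y y' (h : hom y y') := proj1_sig (l1 y y' h).
have kE y y' (h : hom y y') : tf_hom F (k _ _ h) = cast1 (Fr y) (Fr y') h.
  exact: proj2_sig (l1 y y' h).
have l2 y y' (h h' : hom y y') (c : cell h h') :
    {a : cell (k _ _ h) (k _ _ h') | tf_cell F a ≅ cast2 (Fr y) (Fr y') c}.
  apply: constructive_indefinite_description.
  (* The 2-cell is generalised first, so that its ends can be rewritten into images under [F], as
     [surj2] requires. *)
  move: (cast2 _ _ c); rewrite -!kE => d.
  by have [a <-] := surj2 _ _ _ _ d; exists a.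
pose K y y' (h h' : hom y y') (c : cell h h') := proj1_sig (l2 y y' h h' c).
have KE y y' (h h' : hom y y') (c : cell h h') :
    tf_cell F (K _ _ _ _ c) ≅ cast2 (Fr y) (Fr y') c.
  exact: proj2_sig (l2 y y' h h' c).
unshelve eexists (@Twofunctor B A r k K _ _ _ _ _).
- by move=> y; apply: inj1; rewrite kE tf_id1 cast1_id.
- by move=> x y z f g; apply: inj1; rewrite kE tf_comp1 !kE -cast1_comp.
- move=> x y f; apply: heq_eq; apply: tf_heq_inj; apply: heq_trans (KE _ _ _ _ _) _.
  by rewrite cast2_id tf_id2; apply: heq_id2; rewrite kE.
- move=> x y f g h a b; apply: heq_eq; apply: tf_heq_inj; apply: heq_trans (KE _ _ _ _ _) _.
  by rewrite cast2_vcomp tf_vcomp; apply: heq_vcomp; apply: heq_sym.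
- move=> x y z f f' g g' a b; apply: tf_heq_inj; apply: heq_trans (KE _ _ _ _ _) _.
  apply: heq_trans (cast2_hcomp (Fr x) (Fr y) (Fr z) a b) _.
  apply: heq_trans (heq_sym (tf_hcomp _ _ _)).
  by apply: heq_hcomp; apply: heq_sym.
- split.
  + unshelve eapply tf_eq_id; [exact: rF|move=> x y f /=|move=> x y f g a /=].
      by apply: inj1; rewrite kE -tf_cast1.
    apply: tf_heq_inj; apply: heq_trans (KE _ _ _ _ _) _.
    by apply: heq_sym; apply: tf_cast2.
  + by unshelve eapply tf_eq_id.
Qed.

End Bijective.

(** * Extensionality of 2-functors and pseudo-functors *)

Lemma twofunctor_eq (A B : twocat) (o : A -> B)
  (h k : forall x y : A, hom x y -> hom (o x) (o y))
  (c : forall (x y : A) (f g : hom x y), cell f g -> cell (h x y f) (h x y g))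
  (d : forall (x y : A) (f g : hom x y), cell f g -> cell (k x y f) (k x y g))
  p1 p2 p3 p4 p5 q1 q2 q3 q4 q5 :
  (forall x y (f : hom x y), h x y f = k x y f) ->
  (forall x y (f g : hom x y) (a : cell f g), c x y f g a ≅ d x y f g a) ->
  @Twofunctor A B o h c p1 p2 p3 p4 p5 = @Twofunctor A B o k d q1 q2 q3 q4 q5.
Proof.
move=> E.
have {}E : h = k by do 3![apply: functional_extensionality_dep => ?].
subst k => E.
have {}E : c = d.
  by do 5![apply: functional_extensionality_dep => ?]; apply: heq_eq.
by subst d; f_equal; apply: proof_irrelevance.
Qed.

(** As in [twofunctor_eq], both records share the object map [o]: extension and restriction leave
    objects alone, so [≅] suffices and no transport between objects arises. *)
Lemma pseudofunctor_eq (A B : twocat) (o : A -> B)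
  (h k : forall x y : A, hom x y -> hom (o x) (o y))
  (c : forall (x y : A) (f g : hom x y), cell f g -> cell (h x y f) (h x y g))
  (d : forall (x y : A) (f g : hom x y), cell f g -> cell (k x y f) (k x y g))
  u v m n p1 p2 p3 p4 p5 p6 p7 p8 q1 q2 q3 q4 q5 q6 q7 q8 :
  (forall x y (f : hom x y), h x y f = k x y f) ->
  (forall x y (f g : hom x y) (a : cell f g), c x y f g a ≅ d x y f g a) ->
  (forall x, u x ≅ v x) ->
  (forall x y z (f : hom x y) (g : hom y z), m x y z f g ≅ n x y z f g) ->
  @Pseudofunctor A B o h c u m p1 p2 p3 p4 p5 p6 p7 p8 =
  @Pseudofunctor A B o k d v n q1 q2 q3 q4 q5 q6 q7 q8.
Proof.
move=> E.
have {}E : h = k by do 3![apply: functional_extensionality_dep => ?].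
subst k => Ec Eu Em.
have {}Ec : c = d.
  by do 5![apply: functional_extensionality_dep => ?]; apply: heq_eq.
have {}Eu : u = v.
  by apply: functional_extensionality_dep => ?; apply: heq_eq.
have {}Em : m = n.
  by do 5![apply: functional_extensionality_dep => ?]; apply: heq_eq.
by subst d v n; f_equal; apply: proof_irrelevance.
Qed.

(** * Cancellation and pasting in the untyped calculus of 2-cells *)

(** Composing with the inverse of [b] removes it. The sources of [a] and [a'] are not assumed equal,
    which lets the uniqueness arguments below compare 2-cells whose sources agree only
    propositionally. *)
Lemma pV_cancel (C : twocat) (x y : C) (f g h k f' g' : hom x y) (b : cell h k) (a a' : pack x y) :
  invertible b -> typed a f g -> typed a' f' g' -> g = h -> g' = h ->
  pV (pk b) a = pV (pk b) a' -> a = a'.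
Proof.
move=> [b' [e _]] ta ta' eh eh' /(f_equal (pV (pk b'))).
rewrite -!pVA -pk_vcomp e pk_id2.
by rewrite (pV_idl ta) // (pV_idl ta').
Qed.

Lemma pH_split (C : twocat) (x y z : C) (f f' : hom x y) (g g' : hom y z)
  (b : pack y z) (a : pack x y) : typed b g g' -> typed a f f' ->
  pH b a = pV (pH b (pid f')) (pH (pid g) a).
Proof.
move=> tb ta; rewrite -(pH_pV (typed_pid g) tb ta (typed_pid f')) //.
by rewrite (pV_idr tb) // (pV_idl ta).
Qed.

(** Interchange slides [c] past [t], the two hypotheses are applied in turn, and interchange then
    slides [s0] past [d']. This serves to show that lifted transformations respect concatenation. *)
Lemma square_paste (C : twocat) (x y z x' y' z' : C)
  (u : hom x x') (v : hom y y') (w : hom z z') (g g0 : hom x y) (k k0 : hom y z)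
  (h h0 : hom x' y') (l l0 : hom y' z')
  (c : cell g g0) (d : cell k k0) (c' : cell h h0) (d' : cell l l0)
  (s : cell (h ∘ u) (v ∘ g)) (s0 : cell (h0 ∘ u) (v ∘ g0))
  (t : cell (l ∘ v) (w ∘ k)) (t0 : cell (l0 ∘ v) (w ∘ k0)) :
  pV (pH (pid v) (pk c)) (pk s) = pV (pk s0) (pH (pk c') (pid u)) ->
  pV (pH (pid w) (pk d)) (pk t) = pV (pk t0) (pH (pk d') (pid v)) ->
  pV (pH (pid w) (pH (pk d) (pid g0)))
    (pV (pH (pid w) (pH (pid k) (pk c)))
       (pV (pH (pk t) (pid g)) (pH (pid l) (pk s)))) =
  pV (pH (pk t0) (pid g0))
    (pV (pH (pid l0) (pk s0)) (pH (pH (pk d') (pk c')) (pid u))).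
Proof.
move=> Es Et.
rewrite pH_pid2 -(pVA (pH (pid (w ∘ k)) _)) -(pH_xch (typed_pk t) (typed_pk c)).
rewrite !pVA -pHA -(pVA _ (pH (pk t) (pid g0))).
erewrite <- (pH_pVl g0) by first [typ | reflexivity].
rewrite Et -(pH_pid2 v l).
erewrite <- (pH_pVr l) by first [typ | reflexivity].
rewrite Es.
erewrite (pH_pVl g0) by first [typ | reflexivity].
erewrite (pH_pVr l) by first [typ | reflexivity].
rewrite pVA; f_equal.
rewrite -pVA pHA pH_id (pH_xch (typed_pk d') (typed_pk s0)) pVA; f_equal.
by rewrite pHA -(pH_split (typed_pk d') (typed_pH (typed_pk c') (typed_pid u))).
Qed.

Lemma pk_tf_vcomp (A B : twocat) (F : twofunctor A B) (x y : A) (f g h : hom x y)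
  (b : cell g h) (a : cell f g) :
  pk (tf_cell F (b • a)) = pV (pk (tf_cell F b)) (pk (tf_cell F a)).
Proof. by rewrite tf_vcomp pk_vcomp. Qed.

Lemma pk_tf_hcomp (A B : twocat) (F : twofunctor A B) (x y z : A) (f f' : hom x y)
  (g g' : hom y z) (b : cell g g') (a : cell f f') :
  pk (tf_cell F (b ∗ a)) = pH (pk (tf_cell F b)) (pk (tf_cell F a)).
Proof. by rewrite (proj1 (pk_heq _ _) (tf_hcomp F a b)) pk_hcomp. Qed.

(** * The 2-category of paths in a category *)

Section Paths.
Variable A : category.

(** An arrow is added at the target end, so concatenation recurses on the later path and its left
    unit law holds by computation. *)
Inductive path (x : A) : A -> Type :=
| path_nil : path x x
| path_cons y z (f : chom y z) (p : path x y) : path x z.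

Fixpoint path_comp (x y z : A) (q : path y z) : path x y -> path x z :=
  match q in path _ z return path x y -> path x z with
  | path_nil _ => fun p => p
  | path_cons f q => fun p => path_cons f (path_comp q p)
  end.

Fixpoint path_eval (x y : A) (p : path x y) : chom x y :=
  match p in path _ y return chom x y with
  | path_nil _ => cid x
  | path_cons f p => ccomp f (path_eval p)
  end.

Lemma path_compA (x y z t : A) (p : path x y) (q : path y z) (r : path z t) :
  path_comp r (path_comp q p) = path_comp (path_comp r q) p.
Proof. by elim: r q => //= ? ? f r IH q; rewrite IH. Qed.

Lemma path_compr (x y : A) (p : path x y) : path_comp p (path_nil x) = p.
Proof. by elim: p => //= ? ? f p ->. Qed.

Lemma path_eval_comp (x y z : A) (p : path x y) (q : path y z) :
  path_eval (path_comp q p) = ccomp (path_eval q) (path_eval p).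
Proof. by elim: q p => [|? ? f q IH] p /=; rewrite ?ccompl // IH ccompA. Qed.

Lemma path_eval_hcomp (x y z : A) (p p' : path x y) (q q' : path y z) :
  path_eval q = path_eval q' -> path_eval p = path_eval p' ->
  path_eval (path_comp q p) = path_eval (path_comp q' p').
Proof. by rewrite !path_eval_comp => -> ->. Qed.

(** The 1-cells form the free category on the underlying graph of [A]. The 2-cells being proofs,
    their equations hold by proof irrelevance, up to the strict laws for paths. *)
Program Definition path_cat : twocat := {|
  ob := A;
  hom := path;
  cell := fun x y p q => path_eval p = path_eval q;
  id1 := path_nil;
  comp1 := fun x y z q p => path_comp q p;
  id2 := fun x y p => eq_refl;
  vcomp := fun x y p q r b a => eq_trans a b;
  hcomp := fun x y z p p' q q' b a => path_eval_hcomp b a;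
  comp1A := path_compA;
  comp1r := path_compr |}.
Solve All Obligations with
  intros; first [apply: proof_irrelevance | by apply: heq_prop; rewrite /= ?path_compA ?path_compr].

Definition path1 (x y : A) (f : chom x y) : path x y := path_cons f (path_nil x).

Lemma path_eval1 (x y : A) (f : chom x y) : path_eval (path1 f) = f.
Proof. exact: ccompr. Qed.

Lemma path_eval_mult (x y z : A) (f : chom x y) (g : chom y z) :
  path_eval (path_comp (path1 g) (path1 f)) = path_eval (path1 (ccomp g f)).
Proof. by rewrite path_eval_comp !path_eval1. Qed.

Lemma disc_cell_unique (x y : disc A) (f g : hom x y) (a b : cell f g) : a = b.
Proof. exact: (@proof_irrelevance (f = g)). Qed.

Lemma path_cell_unique (x y : path_cat) (p q : hom x y) (a b : cell p q) : a = b.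
Proof. exact: (@proof_irrelevance (path_eval p = path_eval q)). Qed.

Lemma path_cell_heq (x y : path_cat) (p q p' q' : hom x y) (a : cell p q) (b : cell p' q') :
  p = p' -> q = q' -> a ≅ b.
Proof. by move=> e e'; subst; rewrite (path_cell_unique a b). Qed.

Lemma path_cell_inv (x y : path_cat) (p q : hom x y) (a : cell p q) : invertible a.
Proof. by exists (eq_sym a); split; apply: path_cell_unique. Qed.

(** Genuinely pseudo: the empty path differs from the one-arrow path on an identity, and a two-arrow
    path from the one-arrow path on its composite, but their evaluations agree. *)
Program Definition to_paths : pseudofunctor (disc A) path_cat := {|
  pf_ob := fun x => x : path_cat;
  pf_hom := fun x y f => path1 f;
  pf_cell := fun x y f g a => f_equal (fun h => path_eval (path1 h)) a;
  pf_unit := fun x => eq_sym (path_eval1 (cid x));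
  pf_mult := fun x y z f g => path_eval_mult f g |}.
Solve All Obligations with
  intros; first [apply: path_cell_unique | apply: path_cell_inv
    | by apply: path_cell_heq; rewrite /= ?ccompA ?ccompl ?ccompr].

(** Objects are unchanged, so empty paths give the first condition; equalizing the composites of two
    paths in [A] gives the second; parallel 2-cells are always equal, which gives the third. *)
Lemma to_paths_cofinal : filtered A -> two_cofinal to_paths.
Proof.
move=> [i0 cone eqz]; split.
- split=> // [i j f g|i j f g a b].
    (* The equality [e] is itself an invertible 2-cell of [disc A]. *)
    have [k [h e]] := eqz _ _ f g; exists k, h, e, (eq_sym e).
    by split; apply: disc_cell_unique.
  by exists j, (cid j); apply: disc_cell_unique.
- by move=> j; exists j; constructor; apply: path_nil.
- move=> j i a b; have [k [h e]] := eqz _ _ (path_eval a) (path_eval b).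
  have c : path_eval (path_comp (path1 h) a) = path_eval (path_comp (path1 h) b).
    by rewrite !path_eval_comp !path_eval1.
  by exists k, h, c; apply: path_cell_inv.
- by move=> j i a b c d; exists i, (cid i); apply: path_cell_unique.
Qed.

(** * Extension of a pseudo-functor on [A] to a 2-functor on paths *)

Section Extension.
Variables (C : twocat) (F : pseudofunctor (disc A) C).

Lemma pk_disc_cell (x y : A) (f g : chom x y) (e : f = g) :
  pk (@pf_cell (disc A) C F x y f g e) = pid (pf_hom F f).
Proof. by subst g; rewrite (pf_id2 F). Qed.

(** Changing an argument of [pf_mult] changes the type of the 2-cell; packing it makes the rewriting
    possible. *)
Lemma pk_mult_eq (x y z : A) (f f' : chom x y) (g g' : chom y z) :
  f = f' -> g = g' ->
  pk (@pf_mult (disc A) C F x y z f g) = pk (@pf_mult (disc A) C F x y z f' g').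
Proof. by move=> -> ->. Qed.

Fixpoint ext_hom (x y : A) (p : path x y) : hom (F x) (F y) :=
  match p in path _ y return hom (F x) (F y) with
  | path_nil _ => id1 (F x)
  | path_cons f p => @pf_hom (disc A) C F _ _ f ∘ ext_hom p
  end.

Fixpoint ext_eval (x y : A) (p : path x y) :
    cell (ext_hom p) (@pf_hom (disc A) C F x y (path_eval p)) :=
  match p in path _ y
    return cell (ext_hom p) (@pf_hom (disc A) C F x y (path_eval p)) with
  | path_nil _ => pf_unit F x
  | path_cons f p =>
      @pf_mult (disc A) C F _ _ _ (path_eval p) f •
      (id2 (@pf_hom (disc A) C F _ _ f) ∗ ext_eval p)
  end.

Lemma ext_eval_inv (x y : A) (p : path x y) : invertible (ext_eval p).
Proof.
elim: p => [|y' z f p IH] /=; first exact: pf_unit_inv.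
apply: invertible_vcomp; first exact: pf_mult_inv.
by apply: invertible_hcomp => //; apply: invertible_id2.
Qed.

Lemma ext_hom_comp (x y z : A) (p : path x y) (q : path y z) :
  ext_hom (path_comp q p) = ext_hom q ∘ ext_hom p.
Proof. by elim: q p => [|? ? f q IH] p /=; rewrite ?comp1l // IH comp1A. Qed.

(** This is the coherence needed for horizontal composition. By induction on [q], the empty path
    uses the left unit law of [F] and an added arrow uses its associativity law. *)
Lemma ext_eval_comp (x y z : A) (p : path x y) (q : path y z) :
  pk (ext_eval (path_comp q p)) =
  pV (pk (@pf_mult (disc A) C F _ _ _ (path_eval p) (path_eval q)))
    (pH (pk (ext_eval q)) (pk (ext_eval p))).
Proof.
elim: q p => [|y' z' f q IH] p /=.
  have /pk_heq := @pf_unitl (disc A) C F _ _ (path_eval p); pnorm => E.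
  (* An inserted identity is expanded by the unit law, which exposes the common factor [pf_mult]. *)
  rewrite -{1}(pV_idl (typed_pk (ext_eval p)) (eq_refl _)) -E pVA; f_equal.
  by rewrite (pH_split (typed_pk (pf_unit F y)) (typed_pk (ext_eval p))) pH_idl.
have /pk_heq := @pf_assoc (disc A) C F _ _ _ _ (path_eval p) (path_eval q) f; pnorm => E.
pnorm; rewrite IH (pk_mult_eq (path_eval_comp p q) (eq_refl f)).
(* The identity inserted here lets interchange separate [pf_mult] from the comparisons. *)
rewrite -{2}(pV_idl (typed_pk (ext_eval p)) (eq_refl _)).
erewrite (pH_pVr (@pf_hom (disc A) C F _ _ f)) by typ.
erewrite pH_pV by first [typ | reflexivity].
by rewrite -[LHS]pVA -[RHS]pVA pHA; f_equal.
Qed.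

(** Invertibility only asserts that an inverse exists; description provides it as data. *)
Definition ext_inv (x y : A) (p : path x y) :=
  constructive_indefinite_description _ (ext_eval_inv p).

Definition ext_cell (x y : A) (p q : path x y) (e : path_eval p = path_eval q) :
    cell (ext_hom p) (ext_hom q) :=
  proj1_sig (ext_inv q) • @pf_cell (disc A) C F _ _ _ _ e • ext_eval p.

Lemma ext_cellP (x y : A) (p q : path x y) (e : path_eval p = path_eval q) :
  pV (pk (ext_eval q)) (pk (ext_cell e)) = pk (ext_eval p).
Proof.
rewrite -pk_vcomp /ext_cell vcompA (proj2 (proj2_sig (ext_inv q))) vcompl pk_vcomp.
by rewrite pk_disc_cell (pV_idl (typed_pk _)).
Qed.

(** Since [ext_eval q] cancels, compatibility with the comparisons characterizes [ext_cell]; the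
    2-functor laws and both round trips are reduced to this. *)
Lemma ext_cell_unique (x y : A) (p q : path x y) (e : path_eval p = path_eval q)
  (f : hom (F x) (F y)) (a : pack (F x) (F y)) :
  typed a f (ext_hom q) -> pV (pk (ext_eval q)) a = pk (ext_eval p) -> pk (ext_cell e) = a.
Proof.
move=> ta E; apply: (pV_cancel (ext_eval_inv q) (typed_pk _) ta) => //.
by rewrite ext_cellP.
Qed.

Program Definition ext : twofunctor path_cat C := {|
  tf_ob := fun x : path_cat => F x;
  tf_hom := ext_hom;
  tf_cell := ext_cell;
  tf_comp1 := ext_hom_comp |}.
Next Obligation.
apply: eq_pk; apply: ext_cell_unique; first exact: typed_pk.
by rewrite pk_id2 (pV_idr (typed_pk _)).
Qed.
Next Obligation.
apply: eq_pk; apply: ext_cell_unique; first exact: typed_pk.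
by rewrite pk_vcomp -pVA !ext_cellP.
Qed.
Next Obligation.
apply/pk_heq; rewrite pk_hcomp; apply: ext_cell_unique.
  by apply: typed_conv; [apply: typed_pH; apply: typed_pk | | rewrite ext_hom_comp].
(* The comparisons of concatenated paths split, and interchange reduces the claim to each factor. *)
rewrite !ext_eval_comp pVA.
erewrite <- pH_pV by first [typ | reflexivity].
by rewrite !ext_cellP (pk_mult_eq a b).
Qed.

(** This is the right unit law of [F]. It makes the extension restrict to [F] on the nose, and not
    only up to isomorphism. *)
Lemma pk_ext_eval1 (x y : A) (f : chom x y) :
  pk (ext_eval (path1 f)) = pid (@pf_hom (disc A) C F x y f).
Proof.
by have /pk_heq := @pf_unitr (disc A) C F x y f; pnorm.
Qed.

Lemma ext_hom1 (x y : A) (f : chom x y) :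
  ext_hom (path1 f) = @pf_hom (disc A) C F x y f.
Proof. exact: comp1r. Qed.

Lemma precomp_ext : tf_ob (precomp C to_paths) ext = F.
Proof.
(* Eta-expanding [F] puts both sides in constructor form over the same object map. *)
transitivity (Pseudofunctor (pf_id2 F) (pf_vcomp F) (pf_unit_inv F)
  (pf_mult_inv F) (pf_mult_nat F) (pf_unitl F) (pf_unitr F) (pf_assoc F)); last by case: F.
apply: pseudofunctor_eq => [x y f|x y f g a|x|x y z f g].
- exact: ext_hom1.
- apply/pk_heq; case: _ / a; apply: ext_cell_unique.
    by apply: typed_conv; [exact: typed_pk|reflexivity|rewrite ext_hom1].
  by rewrite pk_ext_eval1 pk_disc_cell (pV_idl (typed_pid _)).
(* The unit of [ext F] as a 2-functor is an identity and drops out, leaving [ext_cell] at the unit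
   of [to_paths]; the next case treats [pf_mult] likewise. *)
- apply/pk_heq; rewrite pk_vcomp [X in pV _ X]pk_idcell (pV_idr (typed_pk _)) //.
  apply: (ext_cell_unique (pf_unit to_paths x)).
    by apply: typed_conv; [exact: typed_pk|reflexivity|rewrite ext_hom1].
  by rewrite pk_ext_eval1 (pV_idl (typed_pk _)).
- apply/pk_heq; rewrite pk_vcomp [X in pV _ X]pk_idcell (pV_idr (typed_pk _)).
    exact: (ext_hom_comp (path1 f) (path1 g)).
  apply: (ext_cell_unique (pf_mult to_paths f g)).
    by apply: typed_conv; [exact: typed_pk|reflexivity|rewrite ext_hom1].
  rewrite pk_ext_eval1 (pV_idl (typed_pk _)) // ext_eval_comp !pk_ext_eval1 pH_id.
  by rewrite (pk_mult_eq (path_eval1 f) (path_eval1 g)) (pV_idr (typed_pk _)) //.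
Qed.

End Extension.

(** * A 2-functor on paths is the extension of its restriction *)

Section Retraction.
Variables (C : twocat) (G : twofunctor path_cat C).

(** Any pasting of values of [G] can thus be computed by comparing ends alone. *)
Lemma pk_path_cell (x y : path_cat) (p q p' q' : hom x y) (a : cell p q) (b : cell p' q') :
  p = p' -> q = q' -> pk (tf_cell G a) = pk (tf_cell G b).
Proof. by move=> e e'; subst; rewrite (path_cell_unique a b). Qed.

Notation F := (tf_ob (precomp C to_paths) G).

Definition to_eval (x y : path_cat) (p : hom x y) : cell p (path1 (path_eval p)) :=
  eq_sym (path_eval1 (path_eval p)).

Lemma ext_hom_precomp (x y : A) (p : path x y) : ext_hom F p = tf_hom G p.
Proof.
elim: p => [|z t f p IH] /=; first by rewrite (tf_id1 G).
by rewrite IH -(tf_comp1 G).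
Qed.

(** The structural 2-cells of the restriction are themselves values of [G] up to identities, so the
    comparison built from them is the value of [G] at one 2-cell, determined by its ends. *)
Lemma ext_eval_precomp (x y : A) (p : path x y) :
  pk (ext_eval F p) = pk (tf_cell G (to_eval p)).
Proof.
elim: p => [|z t f p IH] /=.
  rewrite pk_vcomp [X in pV _ X]pk_idcell (pV_idr (typed_pk _)) ?(tf_id1 G) //.
rewrite !pk_vcomp pk_idcell pk_hcomp IH (pV_idr (typed_pk _)); first by rewrite -(tf_comp1 G).
(* Writing the identity as a value of [G] lets the whole pasting be gathered under [G]. *)
have -> : pk (id2 (tf_hom G (path1 f))) = pk (tf_cell G (id2 (path1 f : hom (z : path_cat) t))).
  by rewrite tf_id2.
rewrite -pk_hcomp -(proj1 (pk_heq _ _) (tf_hcomp _ _ _)) -pk_vcomp -tf_vcomp.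
exact: pk_path_cell.
Qed.

Lemma ext_precomp : ext F = G.
Proof.
transitivity (Twofunctor (tf_id1 G) (tf_comp1 G) (tf_id2 G) (tf_vcomp G) (@tf_hcomp _ _ G));
  last by case: G.
apply: twofunctor_eq => [x y p|x y p q a]; first exact: ext_hom_precomp.
apply/pk_heq; apply: ext_cell_unique.
  by apply: typed_conv; [exact: typed_pk|reflexivity|rewrite ext_hom_precomp].
rewrite !ext_eval_precomp -pk_vcomp -tf_vcomp.
by apply: pk_path_cell; rewrite // (a : path_eval p = path_eval q).
Qed.

Lemma pk_to_eval1 (x y : A) (f : chom x y) :
  pk (tf_cell G (to_eval (path1 f))) = pid (tf_hom G (path1 f)).
Proof.
by rewrite -pk_id2 -tf_id2; apply: pk_path_cell; rewrite ?path_eval1.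
Qed.

Lemma pk_precomp_unit (x : A) :
  pk (@pf_unit (disc A) _ F x) = pk (tf_cell G (to_eval (path_nil x))).
Proof.
by rewrite pk_vcomp [X in pV _ X]pk_idcell (pV_idr (typed_pk _)) ?(tf_id1 G) //; exact: (tf_id1 G).
Qed.

Lemma pk_precomp_mult (x y z : A) (p : path x y) (q : path y z) :
  pV (pk (@pf_mult (disc A) _ F x y z (path_eval p) (path_eval q)))
    (pH (pk (tf_cell G (to_eval q))) (pk (tf_cell G (to_eval p)))) =
  pk (tf_cell G (to_eval (path_comp q p))).
Proof.
rewrite pk_vcomp [X in pV (pV _ X) _]pk_idcell (pV_idr (typed_pk _)); first exact: (tf_comp1 G).
rewrite -pk_tf_hcomp -pk_tf_vcomp.
by apply: pk_path_cell; rewrite ?path_eval_comp.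
Qed.

End Retraction.

(** * Restriction is bijective on transformations and modifications *)

Section Transformations.
Variables (C : twocat) (G H : twofunctor path_cat C).

Lemma path_whisker_inv (x y : path_cat) (p q : hom x y) (a : cell p q) (z : C)
  (f : hom (G y) z) : invertible (id2 f ∗ tf_cell G a).
Proof.
apply: invertible_hcomp; first exact: invertible_id2.
exact: (@pf_cell_inv _ _ (pseudo G) _ _ _ _ _ (path_cell_inv a)).
Qed.

(** Naturality at [to_eval p] ties the component at [p] to the one at a one-arrow path, through an
    invertible 2-cell that cancels. *)
Lemma pn_precomp_inj (s t : pseudonat (pseudo G) (pseudo H)) :
  pn_precomp to_paths s = pn_precomp to_paths t -> s = t.
Proof.
move=> E.
have Eo x : s x = t x := f_equal (fun u => @pn_ob (disc A) _ _ _ u x) E.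
have Ec (x y : A) (f : chom x y) :
    pk (pn_cell s (path1 f)) = pk (pn_cell t (path1 f)).
  exact: (f_equal (fun u => pk (@pn_cell (disc A) _ _ _ u _ _ f)) E).
apply: pseudonat_eq => // x y p; apply/pk_heq.
apply: (pV_cancel (path_whisker_inv (to_eval p) (s y)) (typed_pk _) (typed_pk _)) => //.
  by rewrite Eo.
rewrite pk_hcomp.
have /= <- := pn_natP s (to_eval p).
have Ep z : pid (t z) = pid (s z) by rewrite Eo.
by have := pn_natP t (to_eval p); rewrite /= -Ec !Ep.
Qed.

(** * Lifting a transformation from one-arrow paths to all paths *)

Section Lift.
Variable u : pseudonat (pf_comp (pseudo G) to_paths) (pf_comp (pseudo H) to_paths).

Definition of_eval (x y : path_cat) (p : hom x y) : cell (path1 (path_eval p) : hom x y) p :=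
  path_eval1 (path_eval p).

(** Kept opaque: rewriting with [pk_vcomp] would unfold the composite below. *)
Lemma lift_cell_spec (x y : path_cat) (p : hom x y) :
  {c : cell (tf_hom H p ∘ u x) (u y ∘ tf_hom G p) | invertible c /\
   pV (pH (pid (u y)) (pk (tf_cell G (to_eval p)))) (pk c) =
   pV (pk (@pn_cell (disc A) _ _ _ u x y (path_eval p)))
     (pH (pk (tf_cell H (to_eval p))) (pid (u x)))}.
Proof.
exists ((id2 (u y) ∗ tf_cell G (of_eval p)) •
  @pn_cell (disc A) _ _ _ u x y (path_eval p) •
  (tf_cell H (to_eval p) ∗ id2 (u x))); split.
  apply: invertible_vcomp; first exact: path_whisker_inv.
  apply: invertible_vcomp; first exact: (@pn_inv (disc A) _ _ _ u).
  apply: invertible_hcomp; last exact: invertible_id2.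
  exact: (@pf_cell_inv _ _ (pseudo H) _ _ _ _ _ (path_cell_inv _)).
rewrite -pk_hcomp -pk_vcomp vcompA -hcomp_vcomp -tf_vcomp.
rewrite (path_cell_unique (_ • _) (id2 _)) tf_id2 vcompl hcomp_id2 vcompl.
by rewrite pk_vcomp.
Qed.

Definition lift_cell (x y : path_cat) (p : hom x y) := proj1_sig (lift_cell_spec p).

Lemma lift_cellP (x y : path_cat) (p : hom x y) :
  pV (pH (pid (u y)) (pk (tf_cell G (to_eval p)))) (pk (lift_cell p)) =
  pV (pk (@pn_cell (disc A) _ _ _ u x y (path_eval p)))
    (pH (pk (tf_cell H (to_eval p))) (pid (u x))).
Proof. exact: proj2 (proj2_sig (lift_cell_spec p)). Qed.

(** As [to_eval p] is invertible, the naturality square at it determines the lifted cell; units,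
    concatenation and restriction are checked through this square. *)
Lemma lift_cell_unique (x y : path_cat) (p : hom x y) (f : hom (G x) (H y))
  (a : pack (G x) (H y)) :
  typed a f (u y ∘ tf_hom G p) ->
  pV (pH (pid (u y)) (pk (tf_cell G (to_eval p)))) a =
  pV (pk (@pn_cell (disc A) _ _ _ u x y (path_eval p)))
    (pH (pk (tf_cell H (to_eval p))) (pid (u x))) ->
  pk (lift_cell p) = a.
Proof.
move=> ta; rewrite -lift_cellP -pk_hcomp => E.
exact: (pV_cancel (path_whisker_inv (to_eval p) (u y)) (typed_pk _) ta).
Qed.

Lemma pk_pn_eq (x y : A) (f g : chom x y) : f = g ->
  pk (@pn_cell (disc A) _ _ _ u x y f) = pk (@pn_cell (disc A) _ _ _ u x y g).
Proof. by move=> ->. Qed.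

Lemma lift_cell_nat (x y : path_cat) (p q : hom x y) (a : cell p q) :
  lift_cell q • (tf_cell H a ∗ id2 (u x)) = (id2 (u y) ∗ tf_cell G a) • lift_cell p.
Proof.
apply: eq_pk.
apply: (pV_cancel (path_whisker_inv (to_eval q) (u y)) (typed_pk _) (typed_pk _)) => //.
rewrite !pk_vcomp !pk_hcomp !pk_id2 -[LHS]pVA lift_cellP -[RHS]pVA [LHS]pVA.
erewrite <- (pH_pVl (u x)) by first [typ | reflexivity].
erewrite <- (pH_pVr (u y)) by first [typ | reflexivity].
rewrite -!pk_tf_vcomp.
(* By [a] the two one-arrow paths coincide, so [to_eval q] after [a] has the ends of [to_eval p],
   hence the same values under [G] and [H]. *)
have e : path1 (path_eval q) = path1 (path_eval p) by rewrite (a : path_eval p = path_eval q).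
rewrite (pk_path_cell G _ (to_eval p) (eq_refl p) e) lift_cellP.
rewrite (pk_path_cell H _ (to_eval p) (eq_refl p) e).
by rewrite (pk_pn_eq (a : path_eval p = path_eval q)).
Qed.

Lemma lift_cell1 (x y : A) (f : chom x y) :
  pk (lift_cell (path1 f)) = pk (@pn_cell (disc A) _ _ _ u x y f).
Proof.
apply: lift_cell_unique; first exact: typed_pk.
rewrite !pk_to_eval1 !pH_id (pk_pn_eq (path_eval1 f)).
by rewrite (pV_idl (typed_pk _)) // (pV_idr (typed_pk _)).
Qed.

Lemma lift_cell_id (x : path_cat) : pk (lift_cell (id1 x)) = pid (u x).
Proof.
apply: lift_cell_unique.
  by apply: typed_conv; [exact: typed_pid|reflexivity|rewrite tf_id1 comp1r].
have := pn_unitP u x; rewrite !pk_precomp_unit => ->.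
by rewrite (pV_idr (typed_pH (typed_pid _) (typed_pk _))) // tf_id1 comp1r.
Qed.

(** The multiplication law of [u] treats the one-arrow paths; pasting the squares that define the
    lifts at [p] and [q] carries it over to the paths themselves. *)
Lemma lift_cell_comp (x y z : path_cat) (p : hom x y) (q : hom y z) :
  pk (lift_cell (q ∘ p)) =
  pV (pH (pk (lift_cell q)) (pid (tf_hom G p))) (pH (pid (tf_hom H q)) (pk (lift_cell p))).
Proof.
apply: lift_cell_unique.
  apply: typed_conv; [typ|reflexivity|by rewrite tf_comp1 comp1A].
have := pn_multP u (path_eval p : @hom (disc A) _ _) (path_eval q) => E.
rewrite -(pk_precomp_mult G p q) -(pk_precomp_mult H p q).
rewrite (pk_pn_eq (path_eval_comp p q)).
rewrite (pH_split (typed_pk (tf_cell G (to_eval q))) (typed_pk (tf_cell G (to_eval p)))).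
do 2 (erewrite (pH_pVr (u z)) by first [typ | reflexivity]).
erewrite (pH_pVl (u x)) by first [typ | reflexivity].
rewrite -[RHS]pVA E !pVA; f_equal.
exact: square_paste (lift_cellP p) (lift_cellP q).
Qed.

Program Definition pn_lift : pseudonat (pseudo G) (pseudo H) := {|
  pn_ob := fun x : path_cat => pn_ob u x;
  pn_cell := lift_cell |}.
Next Obligation. exact: proj1 (proj2_sig (lift_cell_spec f)). Qed.
Next Obligation. exact: lift_cell_nat. Qed.
Next Obligation.
apply/pk_heq; rewrite pk_vcomp !pk_hcomp [pk (lift_cell _)]lift_cell_id.
rewrite !pk_idcell !pk_id2 !pH_id comp1l comp1r.
exact: (pV_idl (typed_pid _)).
Qed.
Next Obligation.
by apply/pk_heq; move: (lift_cell_comp f g); pnorm.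
Qed.

Lemma precomp_lift : pn_precomp to_paths pn_lift = u.
Proof.
by apply: pseudonat_eq => // x y f; apply/pk_heq; apply: lift_cell1.
Qed.

End Lift.

(** * Lifting modifications *)

Section Modifications.
Variables s t : pseudonat (pseudo G) (pseudo H).

(** A modification is determined by its components at objects, and [to_paths] is the identity on
    objects. *)
Lemma mo_precomp_inj (m n : modif s t) :
  mo_precomp to_paths m = mo_precomp to_paths n -> m = n.
Proof.
move=> E; apply: modif_eq => x.
exact: (f_equal (fun k => @mo_cell (disc A) _ _ _ _ _ k x) E).
Qed.

Variable n : modif (pn_precomp to_paths s) (pn_precomp to_paths t).

Program Definition mo_lift : modif s t := {| mo_cell := fun x : path_cat => mo_cell n x |}.
Next Obligation.
apply: eq_pk.
have /= E := mo_natP n (path_eval f).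
(* After whiskering with [to_eval f], naturality of [s] and [t] moves the claim to a one-arrow path,
   where it is the axiom of [n]. *)
apply: (pV_cancel (path_whisker_inv (to_eval f) (t y)) (typed_pk _) (typed_pk _)) => //.
rewrite !pk_vcomp !pk_hcomp !pk_id2.
have /= Es := pn_natP s (to_eval f); have /= Et := pn_natP t (to_eval f).
rewrite -[LHS]pVA -Et pVA (pH_xch (typed_pk _) (typed_pk _)).
by rewrite -[LHS]pVA E pVA Es -[LHS]pVA (pH_xch (typed_pk _) (typed_pk _)) pVA.
Qed.

Lemma precomp_mo_lift : mo_precomp to_paths mo_lift = n.
Proof. exact: modif_eq. Qed.

End Modifications.
End Transformations.

(** * Assembly of the strict isomorphism, with [ext] as inverse on objects *)

Lemma precomp_isomorphism (C : twocat) : isomorphism (precomp C to_paths).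
Proof.
apply: (@bijective_isomorphism _ _ (precomp C to_paths) _ _ (@ext C)).
- move=> G H s t; exact: pn_precomp_inj.
- move=> G H s t m n; exact: mo_precomp_inj.
- by move=> G; rewrite ext_precomp.
- by move=> F; rewrite precomp_ext.
- move=> G H u; exists (pn_lift u); exact: precomp_lift.
- move=> G H s t n; exists (mo_lift n); exact: precomp_mo_lift.
Qed.

End Paths.

Theorem proposition1p4p5 (A : category) :
  exists (Ahat : twocat) (T : pseudofunctor (disc A) Ahat),
    (forall C : twocat, isomorphism (precomp C T)) /\
    (filtered A -> two_cofinal T).
Proof.
exists (path_cat A), (to_paths A); split; last exact: to_paths_cofinal.
exact: precomp_isomorphism.
Qed.
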